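(* Let $W\in\mathbb{R}^{N\times N}$ be a (weighted, entrywise non-negative) adjacency matrix, let $c>0$, and let $L_1,L_2\in\mathbb{R}^{N\times N}$ be graph Laplacians. Consider the second-order serial consensus controller $$u(x,t)=u_{\mathrm{ref}}(t)-(L_2+L_1)\dot x(t)-L_2L_1x(t).$$ If $L_1,L_2\in\mathcal{A}^1(W,c)$, then the controller is a $2$-step implementable relative feedback controller with respect to $W$ and gain $c'=\max\{2c,c^2\}$; that is, both feedback matrices satisfy $-(L_2+L_1)\in\mathcal{A}^2(W,c')$ and $-L_2L_1\in\mathcal{A}^2(W,c')$.
   Context: Graph Laplacian: a matrix $L\in\mathbb{R}^{N\times N}$ is a (weighted, directed) graph Laplacian if there are weights $w_{i,j}\ge 0$ with $[L]_{i,j}=-w_{i,j}$ for $i\ne j$ and $[L]_{i,i}=\sum_{k\ne i}w_{i,k}$. For an adjacency matrix $W$, an integer $q\ge 0$ and $c>0$, define $$\mathcal{A}^q(W,c)=\left\{A\in\mathbb{R}^{N\times N}\ :\ \left(\Big[\sum_{k=0}^{q}W^k\Big]_{i,j}=0\implies A_{i,j}=0\ \text{ for all } i,j\right),\ A\mathbf{1}=0,\ \|A\|_\infty\le c\right\},$$ where $W^0=I$, $\mathbf 1$ is the all-ones vector, and $\|A\|_\infty=\sup_{\|x\|_\infty=1}\|Ax\|_\infty$ is the matrix norm induced by $\|z\|_\infty=\max_k|z_k|$. A relative state feedback $u=Ax$ is $q$-step implementable with respect to $W$ and gain $c$ if $A\in\mathcal{A}^q(W,c)$; a controller $u=u_{\mathrm{ref}}+A_1\dot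 x+A_0x$ is $q$-step implementable with respect to $W$ and gain $c$ if both $A_0,A_1\in\mathcal{A}^q(W,c)$. Here $x(t)\in\mathbb{R}^N$ is the state (positions) and $u_{\mathrm{ref}}(t)\in\mathbb{R}^N$ a feedforward term. *)

(* Defs.v *)
From HB Require Import structures.
From mathcomp Require Import all_boot all_order all_algebra.
From mathcomp Require Import all_classical all_reals all_analysis.

Set Implicit Arguments.
Unset Strict Implicit.
Unset Printing Implicit Defensive.

Import Order.TTheory GRing.Theory Num.Theory numFieldNormedType.Exports.

Local Open Scope classical_set_scope.
Local Open Scope ring_scope.

Definition adjacency_matrix (R : realType) (N : nat) (W : 'M[R]_N) : Prop :=
  forall i j, 0 <= W i j.

Definition graph_laplacian (R : realType) (N : nat) (L : 'M[R]_N) : Prop :=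
  exists w : 'M[R]_N,
    [/\ forall i j, 0 <= w i j,
        forall i j, i != j -> L i j = - w i j
      & forall i, L i i = \sum_(k < N | k != i) w i k].

(* The library norm [`|z|] of a column vector is the maximum of the absolute
   values of its entries, so this is the norm induced by the sup norm.  The set
   is bounded, and nonempty for [0 < N]; for [N = 0] the value is [sup set0 = 0]. *)
Definition norm_oo (R : realType) (N : nat) (A : 'M[R]_N) : R :=
  sup [set `|A *m x| | x in [set x : 'cV[R]_N | `|x| = 1]].

Definition feedback_set (R : realType) (N q : nat) (W : 'M[R]_N) (c : R) :
    set 'M[R]_N :=
  [set A : 'M[R]_N |
    [/\ forall i j, (\sum_(k < q.+1) W ^+ k : 'M[R]_N) i j = 0 -> A i j = 0,
        A *m const_mx 1 = 0 :> 'cV[R]_N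
      & norm_oo A <= c]].

(* A control law assigns an input to a trajectory [x] and a time [t]; it may use
   the velocity [derive1 x t]. *)
Definition controller (R : realType) (N : nat) : Type :=
  (R -> 'cV[R]_N) -> R -> 'cV[R]_N.

(* The representation is required only where the velocity exists, since [derive1 x t]
   has a meaningless value elsewhere.  It determines [u_ref], [A1] and [A0]. *)
Definition implementable (R : realType) (N q : nat) (W : 'M[R]_N) (c : R)
    (u : controller R N) : Prop :=
  exists (u_ref : R -> 'cV[R]_N) (A1 A0 : 'M[R]_N),
    [/\ forall (x : R -> 'cV[R]_N) (t : R), derivable x t 1 ->
          u x t = u_ref t + A1 *m derive1 x t + A0 *m x t,
        feedback_set q W c A0
      & feedback_set q W c A1].

Definition serial_consensus (R : realType) (N : nat) (u_ref : R -> 'cV[R]_N)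
    (L1 L2 : 'M[R]_N) : controller R N :=
  fun x t => u_ref t - (L2 + L1) *m derive1 x t - (L2 *m L1) *m x t.

(* Main.v *)
(** The support condition is multiplicative because [W] is entrywise
    non-negative: a nonzero entry [(A B)_ij] yields an index [k] with
    [A_ik] and [B_kj] nonzero, hence exponents [m <= p] and [n <= q] with
    [(W^m)_ik] and [(W^n)_kj] nonzero, and no cancellation can occur in
    [(W^(m+n))_ij >= (W^m)_ik (W^n)_kj].  The norm bounds are
    subadditivity and submultiplicativity of the induced norm. *)

Require Import Defs.
From HB Require Import structures.
From mathcomp Require Import all_boot all_order all_algebra.
From mathcomp Require Import all_classical all_reals all_analysis.
Import Order.TTheory GRing.Theory Num.Theory numFieldNormedType.Exports.
Local Open Scope ring_scope.

Lemma ler_mx_entry_norm (R : realType) (m n : nat) (A : 'M[R]_(m, n)) i j :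
  `|A i j| <= `|A|.
Proof.
rewrite [leRHS]/Num.Def.normr/= mx_normrE.
exact: (le_bigmax _ (fun ij => `|A ij.1 ij.2|) (i, j)).
Qed.

(** A crude constant suffices: its only purpose is to bound the set in [norm_oo] from above, so that
    its [sup] is a true upper bound. *)
Lemma mulmx_col_bounded (R : realType) (N : nat) (A : 'M[R]_N) :
  exists M : R, forall x : 'cV[R]_N, `|A *m x| <= M * `|x|.
Proof.
exists (\sum_i \sum_k `|A i k|) => x.
have M0 : 0 <= \sum_i \sum_k `|A i k| by do 2 (apply: sumr_ge0 => ? _).
rewrite [leLHS]/Num.Def.normr/= mx_normrE bigmax_le ?mulr_ge0//= => -[i j] _ /=.
rewrite mxE (le_trans (ler_norm_sum _ _ _))//.
apply: (@le_trans _ _ ((\sum_k `|A i k|) * `|x|)).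
  by rewrite mulr_suml ler_sum// => k _; rewrite normrM ler_wpM2l ?ler_mx_entry_norm.
rewrite ler_wpM2r// [leRHS](bigD1 i)//= lerDl sumr_ge0// => l _.
exact: sumr_ge0.
Qed.

Lemma norm_oo_ge0 (R : realType) (N : nat) (A : 'M[R]_N) : 0 <= norm_oo A.
Proof.
rewrite /norm_oo; set S := (X in sup X).
(* A set without a supremum has [sup] equal to 0 by default; otherwise any member is a norm and lies
   below the supremum. *)
have [[[r Sr] ubS]|/sup_out->//] := pselect (has_sup S).
by apply: le_trans (ub_le_sup ubS Sr); case: Sr => x _ <-.
Qed.

Lemma norm_oo_mulmx (R : realType) (N : nat) (A : 'M[R]_N) (x : 'cV[R]_N) :
  `|A *m x| <= norm_oo A * `|x|.
Proof.
have [->|x0] := eqVneq x 0; first by rewrite mulmx0 !normr0 mulr0.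
have nx0 : 0 < `|x| by rewrite normr_gt0.
rewrite -ler_pdivrMr// mulrC.
have [M hM] := mulmx_col_bounded _ _ A.
apply: ub_le_sup.
  by exists M => _ [y /= y1 <-]; rewrite (le_trans (hM y))// y1 mulr1.
(* Normalising [x] gives a unit vector whose image has norm [|A x| / |x|]. *)
exists (`|x|^-1 *: x) => /=.
  by rewrite normrZ normfV normr_id mulVf ?gt_eqF.
by rewrite -scalemxAr normrZ normfV normr_id.
Qed.

Lemma norm_oo_le (R : realType) (N : nat) (A : 'M[R]_N) (c : R) :
  0 <= c -> (forall x : 'cV[R]_N, `|A *m x| <= c * `|x|) -> norm_oo A <= c.
Proof.
move=> c0 hc; rewrite /norm_oo.
(* If [N = 0], no vector has norm 1 and the supremum is 0; this case rests on [0 <= c]. *)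
set S := (X in sup X); have [->|S0] := eqVneq S set0; first by rewrite sup0.
apply: ge_sup; first exact/set0P.
by move=> _ [x /= x1 <-]; rewrite (le_trans (hc x))// x1 mulr1.
Qed.

Lemma norm_ooD (R : realType) (N : nat) (A B : 'M[R]_N) :
  norm_oo (A + B) <= norm_oo A + norm_oo B.
Proof.
apply: norm_oo_le => [|x]; first by rewrite addr_ge0 ?norm_oo_ge0.
by rewrite mulmxDl mulrDl (le_trans (ler_normD _ _))// lerD ?norm_oo_mulmx.
Qed.

Lemma norm_ooN (R : realType) (N : nat) (A : 'M[R]_N) :
  norm_oo (- A) <= norm_oo A.
Proof.
apply: norm_oo_le => [|x]; first exact: norm_oo_ge0.
by rewrite mulNmx normrN norm_oo_mulmx.
Qed.

Lemma norm_ooM (R : realType) (N : nat) (A B : 'M[R]_N) :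
  norm_oo (A *m B) <= norm_oo A * norm_oo B.
Proof.
apply: norm_oo_le => [|x]; first by rewrite mulr_ge0 ?norm_oo_ge0.
rewrite -mulmxA (le_trans (norm_oo_mulmx _ _ A _))// -mulrA.
by rewrite ler_wpM2l ?norm_oo_ge0 ?norm_oo_mulmx.
Qed.

Lemma adjacency_expr_ge0 (R : realType) (N : nat) (W : 'M[R]_N) (k : nat) :
  adjacency_matrix W -> forall i j, 0 <= (W ^+ k) i j.
Proof.
move=> hW; elim: k => [|k IH] i j; first by rewrite expr0 mxE ler0n.
by rewrite exprS mxE sumr_ge0// => l _; rewrite mulr_ge0.
Qed.

(** Entries of powers of [W] are non-negative, so a vanishing sum forces each term to vanish. *)
Lemma sum_expr_eq0 (R : realType) (N q : nat) (W : 'M[R]_N) i j :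
  adjacency_matrix W ->
  (\sum_(k < q.+1) W ^+ k) i j = 0 <->
  (forall k, (k <= q)%N -> (W ^+ k) i j = 0).
Proof.
move=> hW; rewrite summxE; split=> [/psumr_eq0P h k kq|h].
  by apply: (h _ (Ordinal (kq : (k < q.+1)%N))) => // l _; exact: adjacency_expr_ge0.
by apply: big1 => k _; apply: h; rewrite -ltnS.
Qed.

Lemma feedback_setN (R : realType) (N q : nat) (W : 'M[R]_N) (c : R) A :
  feedback_set q W c A -> feedback_set q W c (- A).
Proof.
move=> [sA A1 nA]; split=> [i j /sA Aij||].
- by rewrite mxE Aij oppr0.
- by rewrite mulNmx A1 oppr0.
- exact: le_trans (norm_ooN _ _ A) nA.
Qed.

Lemma feedback_setD (R : realType) (N q : nat) (W : 'M[R]_N) (a b : R) A B :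
  feedback_set q W a A -> feedback_set q W b B ->
  feedback_set q W (a + b) (A + B).
Proof.
move=> [sA A1 nA] [sB B1 nB]; split=> [i j Wij||].
- by rewrite mxE sA// sB// addr0.
- by rewrite mulmxDl A1 B1 addr0.
- exact: le_trans (norm_ooD _ _ A B) (lerD nA nB).
Qed.

Lemma feedback_setM (R : realType) (N p q : nat) (W : 'M[R]_N) (a b : R) A B :
  adjacency_matrix W -> feedback_set p W a A -> feedback_set q W b B ->
  feedback_set (p + q) W (a * b) (A *m B).
Proof.
move=> hW [sA A1 nA] [sB B1 nB]; split=> [i j||].
- move=> /sum_expr_eq0-/(_ hW) Wij; rewrite mxE big1// => k _.
  apply/eqP; rewrite mulf_eq0; apply/norP => -[Aik Bkj].
  have {Aik} [m mp Wik] : exists2 m, (m <= p)%N & (W ^+ m) i k != 0.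
    (* Contrapositive: if every power up to [p] vanishes at [(i, k)], the support condition forces
       [A i k = 0]. *)
    apply: contra_neqP Aik => h; apply/sA/sum_expr_eq0 => // m mp.
    by apply/eqP/negPn/negP => Wm; apply: h; exists m.
  have {Bkj} [n nq Wkj] : exists2 n, (n <= q)%N & (W ^+ n) k j != 0.
    apply: contra_neqP Bkj => h; apply/sB/sum_expr_eq0 => // n nq.
    by apply/eqP/negPn/negP => Wn; apply: h; exists n.
  (* The entry of [W ^+ (m + n)] at [(i, j)] is zero and is a sum of non-negative products, so the
     product through [k] is zero, against the choice of [m] and [n]. *)
  have := Wij _ (leq_add mp nq); rewrite exprD mxE => /psumr_eq0P h.
  have /eqP : (W ^+ m) i k * (W ^+ n) k j = 0.
    by apply: h => // l _; rewrite mulr_ge0 ?adjacency_expr_ge0.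
  by rewrite mulf_eq0 (negPf Wik) (negPf Wkj).
- by rewrite -mulmxA B1 mulmx0.
- by rewrite (le_trans (norm_ooM _ _ A B))// ler_pM ?norm_oo_ge0.
Qed.

(** Adding further non-negative powers can only shrink the set of positions where the sum vanishes,
    so fewer entries are constrained. *)
Lemma feedback_set_sub (R : realType) (N p q : nat) (W : 'M[R]_N) (a b : R) A :
  adjacency_matrix W -> (p <= q)%N -> a <= b ->
  feedback_set p W a A -> feedback_set q W b A.
Proof.
move=> hW pq ab [sA A1 nA]; split=> //; last exact: le_trans nA ab.
move=> i j /sum_expr_eq0-/(_ hW) Wij; apply/sA/sum_expr_eq0 => // k kp.
exact/Wij/(leq_trans kp).
Qed.

Theorem proposition2 (R : realType) (N : nat) (W : 'M[R]_N) (c : R)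
    (L1 L2 : 'M[R]_N) (u_ref : R -> 'cV[R]_N)
    (hW : adjacency_matrix W) (hc : 0 < c)
    (hL1 : graph_laplacian L1) (hL2 : graph_laplacian L2)
    (hA1 : feedback_set 1 W c L1) (hA2 : feedback_set 1 W c L2) :
  [/\ implementable 2 W (Num.max (2 * c) (c ^+ 2)) (serial_consensus u_ref L1 L2),
      feedback_set 2 W (Num.max (2 * c) (c ^+ 2)) (- (L2 + L1))
    & feedback_set 2 W (Num.max (2 * c) (c ^+ 2)) (- (L2 *m L1))].
Proof.
have hD : feedback_set 2 W (Num.max (2 * c) (c ^+ 2)) (- (L2 + L1)).
  (* The sum stays 1-step, with gain [c + c]. *)
  apply/feedback_setN/(feedback_set_sub _ _ 1 _ _ _ _ _ hW _ _ (feedback_setD _ _ _ _ _ _ _ _ hA2 hA1)) => //.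
  by rewrite le_max mulr_natl mulr2n lexx.
have hM : feedback_set 2 W (Num.max (2 * c) (c ^+ 2)) (- (L2 *m L1)).
  (* The product takes [1 + 1] steps, with gain [c * c]. *)
  apply/feedback_setN/(feedback_set_sub _ _ 2 _ _ _ _ _ hW _ _ (feedback_setM _ _ _ _ _ _ _ _ _ hW hA2 hA1)) => //.
  by rewrite le_max expr2 lexx orbT.
split=> //; exists u_ref, (- (L2 + L1)), (- (L2 *m L1)); split=> // x t _.
by rewrite /serial_consensus !mulNmx.
Qed.
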